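(* Fix an integer $m\geq3$. There exists $N$ (depending on $m$) such that for every finite group $G$ of order $n\geq N$, the proportion of skew set-matrices $\mathcal{S}$ of $G$ such that $m\text{-}\mathrm{Cay}(G,\mathcal{S})$ is an $m$-PGSR of $G$ is greater than $1-m^2/\sqrt{n}$.
   Context: A set-matrix of a group $G$ is an $m\times m$ matrix $\mathcal{S}=(S_{i,j})$ whose entries are subsets of $G$. The $m$-Cayley digraph $m\text{-}\mathrm{Cay}(G,\mathcal{S})$ has vertex set $G\times\{1,\ldots,m\}$ and arc set $\{((g,i),(sg,j)) : i,j\in\{1,\ldots,m\},\ s\in S_{i,j},\ g\in G\}$. $\mathcal{S}$ is skew if $S_{j,i}=S_{i,j}^{-1}$ for all $i,j$ and $S_{i,i}=\emptyset$ for all $i$; then $m\text{-}\mathrm{Cay}(G,\mathcal{S})$ is an undirected $m$-partite graph with parts $G\times\{i\}$. It is an $m$-PGSR ($m$-partite graphical semiregular representation) of $G$ if its automorphism group is isomorphic to $G$. The proportion is taken among all skew set-matrices of $G$. *)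

(* Defs.v *)
From HB Require Import structures.
From mathcomp Require Import all_boot all_order all_algebra all_fingroup.

Set Implicit Arguments.
Unset Strict Implicit.
Unset Printing Implicit Defensive.

Import GroupScope.

Section GraphAut.
Variables (V : finType) (e : rel V).

Definition graph_aut : {set {perm V}} :=
  [set p : {perm V} | [forall x, forall y, e (p x) (p y) == e x y]].

Lemma graph_aut_group_set : group_set graph_aut.
Proof.
apply/group_setP; split.
  by rewrite inE; apply/'forall_forallP => x y; rewrite !perm1.
move=> p q; rewrite !inE => /'forall_'forall_eqP Hp /'forall_'forall_eqP Hq.
by apply/'forall_'forall_eqP => x y; rewrite !permM Hq Hp.
Qed.
Canonical graph_aut_group := Group graph_aut_group_set.

End GraphAut.

Section MCayley.
Variables (gT : finGroupType) (m : nat).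
Implicit Type S : 'M[{set gT}]_m.

Definition mCay S : rel (gT * 'I_m) :=
  [rel x y | [exists s in S x.2 y.2, y.1 == s * x.1]].

(* The inverse of a set is the pointwise one, {s^-1 | s in S_(i,j)}. *)
Definition skew_setmx S : bool :=
  [forall i, forall j, S j i == (S i j)^-1] && [forall i, S i i == set0].

Definition is_mPGSR S : bool := graph_aut (mCay S) \isog [set: gT].

Definition skew_matrices : {set 'M[{set gT}]_m} :=
  [set S : 'M[{set gT}]_m | skew_setmx S].

Definition mPGSR_matrices : {set 'M[{set gT}]_m} :=
  [set S in skew_matrices | is_mPGSR S].

End MCayley.

Arguments skew_matrices gT m : clear implicits.
Arguments mPGSR_matrices gT m : clear implicits.

Definition mPGSR_proportion (R : rcfType) (gT : finGroupType) (m : nat) : R :=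
  (#|mPGSR_matrices gT m|%:R / #|skew_matrices gT m|%:R)%R.
Arguments mPGSR_proportion R gT m : clear implicits.

(* Main.v *)
Require Import Defs.
From HB Require Import structures.
From mathcomp Require Import all_boot all_order all_algebra all_fingroup.
From mathcomp Require Import zify ring.
Import Order.TTheory GRing.Theory Num.Theory.

Set Implicit Arguments.
Unset Strict Implicit.
Unset Printing Implicit Defensive.

(** Let n = |G| and call G x {i} the parts; e(x, y) is adjacency. The right
    translations are always automorphisms, so it suffices to show that there is
    no other automorphism, outside a proportion O(m^3 / n) of the skew
    set-matrices.

    1. The agreement of x and y, i.e. the sum over z of the signs
    (-1)^(e(x,z) + e(y,z)), is n plus noise if x and y lie in the same part,
    and noise otherwise, and the noise has second moment O(mn). By Chebyshev,
    outside a proportion O(m^3 / n), all but n/8 vertices y agree with x as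
    expected, whatever x is; the automorphisms then preserve "being in the same
    part".

    2. Fix k = O(log n) elements v_l of G. Up to a proportion m^2 / n, for all
    i <> j the vertices of part j are separated by their adjacencies to the
    (v_l, i). The restriction of an automorphism f to part j is then determined
    by the images of the (v_l, i) and by the entries of the matrix at (i, j) and
    (f(i), f(j)). There are only (mn)^k = 2^O(log^2 n) possible images, so a
    union bound over them is affordable.

    3. If f carries part j to a part b <> j, take i distinct from j and b. The
    entry (i, j) is determined by the other entries and the images of the
    (v_l, b) and (1, i), so the proportion is at most (mn)^O(k) / 2^n.

    4. If f fixes all parts, take distinct parts p0, p1, p2. The images of the
    (v_l, p0) determine f on p1 and p2, say as f1 and f2, and the entry
    (p1, p2) is invariant under all the moves s -> f2(sg) f1(g)^-1. The
    elements fixed by all these moves lie in a coset of a subgroup, so either f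
    is a translation or at least n/2 elements are moved, and the proportion is
    at most (mn)^k / 2^(n/4). *)

(** * Counting *)

(** Proportions are handled with denominators cleared: when [C] counts the whole space, each [F d]
    has proportion at most 1/c, and [X] at most #|D|/c. *)
Lemma union_bound (T D : finType) (X : {set T}) (F : D -> {set T}) c C :
  (forall S, S \in X -> exists d, S \in F d) ->
  (forall d, #|F d| * c <= C) -> #|X| * c <= #|D| * C.
Proof.
move=> XF Fc.
have leXF : #|X| <= \sum_d #|F d|.
  have -> : \sum_d #|F d| = \sum_S \sum_d (S \in F d).
    by rewrite exchange_big; apply: eq_bigr => d _; rewrite -sum1_card big_mkcond.
  rewrite -sum1_card big_mkcond; apply: leq_sum => S _.
  case: ifP => // /XF [d SFd].
  by rewrite (bigD1 d) //= SFd.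
apply: leq_trans (leq_mul leXF (leqnn c)) _.
rewrite big_distrl /= -sum_nat_const.
by apply: leq_sum => d _; apply: Fc.
Qed.

Definition toggle (T : finType) (s : T) (A : {set T}) : {set T} :=
  [set x | (x \in A) (+) (x == s)].

Lemma toggleK (T : finType) (s : T) : involutive (toggle s).
Proof. by move=> A; apply/setP => x; rewrite !inE -addbA addbb addbF. Qed.

Section ConstantPairs.
Variables (T : finType) (p : T -> T).
Implicit Type M : {set T}.

Definition constant_pairs M : {set {set T}} :=
  [set A : {set T} | [forall s in M, (s \in A) == (p s \in A)]].

Lemma constant_pairsS M M' :
  M' \subset M -> constant_pairs M \subset constant_pairs M'.
Proof.
move=> /subsetP sM; apply/subsetP => A; rewrite !inE.
by move=> /'forall_implyP H; apply/'forall_implyP => s /sM /H.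
Qed.

(** No other constraint mentions [s], so toggling [s] breaks the constraint at [s] and keeps the
    rest: the relaxed family contains two disjoint copies of the constrained one. *)
Lemma constant_pairs_leaf M s :
  s \in M -> p s != s -> (forall t, t \in M -> p t != s) ->
  2 * #|constant_pairs M| <= #|constant_pairs (M :\ s)|.
Proof.
move=> sM nps pM.
have disj : [disjoint constant_pairs M & toggle s @: constant_pairs M].
  apply/pred0P => A /=; apply/negP => /andP[AM] /imsetP[B BM defA].
  move: AM BM; rewrite {}defA !inE => /'forall_implyP/(_ s sM) + /'forall_implyP/(_ s sM).
  by rewrite !inE eqxx (negPf nps) addbT addbF => /eqP <-; case: (_ \in _).
rewrite mul2n -addnn -{2}(card_imset (constant_pairs M) (inv_inj (@toggleK _ s))).
rewrite -cardsUI (_ : _ :&: _ = set0); last by apply/eqP; rewrite setI_eq0.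
rewrite cards0 addn0; apply/subset_leq_card; rewrite subUset.
rewrite constant_pairsS ?subD1set //=; apply/subsetP => _ /imsetP[A AM ->].
move: AM; rewrite !inE => /'forall_implyP AM; apply/'forall_implyP => t.
by rewrite !inE => /andP[nts tM]; rewrite (negPf nts) (negPf (pM t tM)) !addbF AM.
Qed.

(* Each step frees one coordinate at the cost of at most two constraints: one
   if some point of M is not a value of p on M, and two if p permutes M. *)
Lemma card_constant_pairs M :
  (forall s, s \in M -> p s != s) ->
  #|constant_pairs M| * 2 ^ uphalf #|M| <= 2 ^ #|T|.
Proof.
have [N] := ubnP #|M|; elim: N => // N IHN in M *; rewrite ltnS => leMN nfix.
have [->|] := eqVneq M set0.
  by rewrite cards0 muln1 -cardsT -card_powerset powersetT subset_leq_card ?subsetT.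
move=> M_neq0.
have IH M' : M' \proper M -> #|constant_pairs M'| * 2 ^ uphalf #|M'| <= 2 ^ #|T|.
  move=> pM; apply: IHN; first exact: leq_trans (proper_card pM) _.
  by move=> s /(subsetP (proper_sub pM)); apply: nfix.
have [sub|] := boolP (M \subset p @: M); last first.
  case/subsetPn => s sM npM.
  have leaf : forall t, t \in M -> p t != s.
    by move=> t tM; apply: contraNneq npM => <-; apply: imset_f.
  have := constant_pairs_leaf sM (nfix s sM) leaf.
  have := IH (M :\ s) (properD1 sM); rewrite (cardsD1 s M) sM add1n /=.
  move=> IH1 le2; apply: leq_trans IH1.
  have : uphalf #|M :\ s|.+1 <= (uphalf #|M :\ s|).+1 by lia.
  move=> /(leq_pexp2l (isT : 0 < 2)) le3.
  apply: leq_trans (leq_mul (leqnn _) le3) _.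
  by rewrite expnS mulnCA mulnA leq_mul2r le2 orbT.
have injp : {in M &, injective p}.
  apply/imset_injP; rewrite eqn_leq leq_imset_card /=.
  exact: subset_leq_card.
(* Relaxing the constraint at [t], the only preimage of [s] in [M], turns [s] into a leaf; two
   points go and [uphalf] drops by one. *)
case/set0Pn: M_neq0 => s sM; have /imsetP[t tM defs] := subsetP sub s sM.
have nts : t != s by rewrite defs eq_sym nfix.
have sMt : s \in M :\ t by rewrite !inE eq_sym nts.
have leaf : forall u, u \in M :\ t -> p u != s.
  move=> u; rewrite !inE => /andP[nut uM]; apply: contraNneq nut.
  by rewrite defs => /injp ->.
have := constant_pairs_leaf sMt (nfix s sM) leaf.
have := subset_leq_card (constant_pairsS (subD1set M t)).
have := IH ((M :\ t) :\ s) (proper_sub_trans (properD1 sMt) (subD1set _ _)).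
rewrite (cardsD1 t M) tM (cardsD1 s (M :\ t)) sMt !add1n => IH1 le1 le2.
apply: leq_trans IH1; rewrite /= expnS mulnA [_ * 2]mulnC.
by rewrite leq_mul2r (leq_trans _ le2) ?orbT // leq_mul2l le1.
Qed.

End ConstantPairs.

Import GroupScope.

(** * Skew set-matrices *)

Section SkewMatrices.
Variables (gT : finGroupType) (m : nat).
Implicit Type (S : 'M[{set gT}]_m) (A : {set gT}) (i j k l : 'I_m).
Implicit Type (x y z : gT * 'I_m).

Lemma mCayE S x y : mCay S x y = (y.1 * x.1^-1 \in S x.2 y.2).
Proof.
apply/existsP/idP => [[s /andP[sS /eqP ->]]|xyS]; first by rewrite mulgK.
by exists (y.1 * x.1^-1); rewrite xyS mulgKV eqxx.
Qed.

Lemma skewP S :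
  reflect ((forall i j, S j i = (S i j)^-1) /\ (forall i, S i i = set0))
          (S \in skew_matrices gT m).
Proof.
rewrite inE; apply: (iffP andP) => [[/'forall_'forall_eqP H1 /'forall_eqP H2]|[H1 H2]].
  by split.
by split; [apply/'forall_'forall_eqP | apply/'forall_eqP].
Qed.

Lemma mCay_sym S : S \in skew_matrices gT m -> symmetric (mCay S).
Proof.
by case/skewP=> SV _; move=> x y; rewrite !mCayE (SV y.2) mem_invg invMg invgK.
Qed.

Lemma mCay_part S x y : S \in skew_matrices gT m -> x.2 = y.2 -> mCay S x y = false.
Proof. by case/skewP => _ S0 exy; rewrite mCayE exy S0 inE. Qed.

Definition upd S i j A : 'M[{set gT}]_m :=
  \matrix_(k, l) if (k == i) && (l == j) then A
                 else if (k == j) && (l == i) then A^-1 else S k l.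

Lemma updE S i j A : upd S i j A i j = A.
Proof. by rewrite mxE !eqxx. Qed.

Lemma upd_skew S i j A :
  i != j -> S \in skew_matrices gT m -> upd S i j A \in skew_matrices gT m.
Proof.
move=> nij /skewP[SV S0]; apply/skewP; split=> [k l|k]; rewrite !mxE.
  rewrite [(l == i) && _]andbC [(l == j) && _]andbC SV.
  have [->|_] := eqVneq k i; rewrite /= ?(negPf nij) /=.
    by have [_|_] := eqVneq l j.
  by case: (k == j); case: (l == i); rewrite ?invgK.
case: (eqVneq k i) => [->|_] /=; rewrite ?(negPf nij) ?andbF ?S0 //.
Qed.

Lemma updK S i j A :
  i != j -> S \in skew_matrices gT m -> upd (upd S i j A) i j (S i j) = S.
Proof.
move=> nij /skewP[SV _]; apply/matrixP => k l; rewrite !mxE.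
case: ifP => [/andP[/eqP-> /eqP->] //|->].
by case: ifP => [/andP[/eqP-> /eqP->]|-> //]; rewrite -SV.
Qed.

Lemma mCay_upd S i j A x y :
  ~~ ((x.2 == i) && (y.2 == j)) -> ~~ ((x.2 == j) && (y.2 == i)) ->
  mCay (upd S i j A) x y = mCay S x y.
Proof. by move=> /negPf n1 /negPf n2; rewrite !mCayE mxE n1 n2. Qed.

(** Resampling one entry: given the other entries, the entry (i, j) of a skew matrix is an arbitrary
    subset, so a uniform bound on fibers bounds the proportion of [X]. *)
Lemma card_fiber (X : {set 'M[{set gT}]_m}) i j c :
  i != j -> X \subset skew_matrices gT m ->
  (forall S, S \in skew_matrices gT m ->
     #|[set A | upd S i j A \in X]| * c <= 2 ^ #|gT|)%N ->
  (#|X| * c <= #|skew_matrices gT m|)%N.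
Proof.
move=> nij /subsetP skX fib.
pose Y := [set SA : 'M[{set gT}]_m * {set gT} |
            (SA.1 \in skew_matrices gT m) && (upd SA.1 i j SA.2 \in X)].
(* [f] exchanges the entry (i, j) with the spare set, so nothing is lost and it is injective. *)
pose f (SA : 'M[{set gT}]_m * {set gT}) := (upd SA.1 i j SA.2, SA.1 i j).
have cardT : #|[set: {set gT}]| = (2 ^ #|gT|)%N.
  by rewrite -powersetT card_powerset cardsT.
have leXY : (#|X| * 2 ^ #|gT| <= #|Y|)%N.
  have injf : {in setX X [set: {set gT}] &, injective f}.
    case=> [S A] [S' A']; rewrite !in_setX !in_setT !andbT /= => /skX SX /skX SX' [eU e0].
    have eA : A = A' by rewrite -(updE S i j A) eU updE.
    by rewrite -(updK A nij SX) eU e0 updK // eA.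
  rewrite -cardT -cardsX -(card_in_imset injf).
  apply/subset_leq_card/subsetP => _ /imsetP[[S A] + ->].
  by rewrite in_setX in_setT andbT inE /= => SX; rewrite upd_skew ?updK ?skX.
have cardY : #|Y| = (\sum_(S in skew_matrices gT m) #|[set A | upd S i j A \in X]|)%N.
  under eq_bigr do rewrite -sum1_card.
  rewrite pair_big_dep -sum1_card; apply: eq_bigl => -[S A].
  by rewrite [LHS]inE /= [X in _ = _ && X]inE.
have : (#|X| * 2 ^ #|gT| * c <= #|skew_matrices gT m| * 2 ^ #|gT|)%N.
  apply: (leq_trans (leq_mul leXY (leqnn c))); rewrite cardY big_distrl /=.
  by rewrite -sum_nat_const; apply: leq_sum => S /fib.
by rewrite mulnAC leq_pmul2r // expn_gt0.
Qed.

Lemma right_mul_inj (h : gT) : injective (fun x : gT * 'I_m => (x.1 * h, x.2)).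
Proof. by move=> [a i] [b j] /= [/mulIg -> ->]. Qed.

Definition trans (h : gT) : {perm gT * 'I_m} := perm (@right_mul_inj h).

Lemma transE h x : trans h x = (x.1 * h, x.2).
Proof. by rewrite permE. Qed.

Lemma graph_autP S (f : {perm gT * 'I_m}) :
  reflect (forall x y, mCay S (f x) (f y) = mCay S x y) (f \in graph_aut (mCay S)).
Proof. by rewrite inE; apply: 'forall_'forall_eqP. Qed.

Lemma trans_aut S h : trans h \in graph_aut (mCay S).
Proof. by apply/graph_autP => x y; rewrite !mCayE !transE /= invMg mulgA mulgK. Qed.

Lemma transM : {morph trans : h k / h * k}.
Proof. by move=> h k; apply/permP => x; rewrite permM !transE /= mulgA. Qed.

Lemma mPGSR_of_trans S : (0 < m)%N ->
  (forall f, f \in graph_aut (mCay S) -> exists h, f = trans h) -> is_mPGSR S.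
Proof.
move=> m_gt0 autT.
pose tr := Morphism (D := [set: gT]) (mfun := trans) (in2W transM).
have trE h : tr h = trans h by [].
rewrite /is_mPGSR isog_sym; apply/isogP; exists [morphism of tr].
  (* The image of the vertex (1, 0) recovers [h]; this vertex exists since [m] is positive. *)
  apply/injmP => h k _ _; rewrite !trE => /permP/(_ (1, Ordinal m_gt0)).
  by rewrite !transE /= !mul1g => -[].
apply/setP => f; apply/morphimP/idP => [[h _ _ ->]|/autT[h ->]].
  by rewrite trE trans_aut.
by exists h => //; rewrite inE.
Qed.

End SkewMatrices.

(** * Automorphisms preserve the partition *)

Section SecondMoment.
Variables (gT : finGroupType) (m : nat).
Implicit Type (S : 'M[{set gT}]_m) (i j : 'I_m) (x y z : gT * 'I_m).
Local Notation n := #|gT|.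
Local Notation skew := (skew_matrices gT m).
Local Open Scope ring_scope.

Definition flip i j (s : gT) S := upd S i j (toggle s (S i j)).

Lemma flip_skew i j s S : i != j -> S \in skew -> flip i j s S \in skew.
Proof. exact: upd_skew. Qed.

Lemma flipK i j s S : i != j -> S \in skew -> flip i j s (flip i j s S) = S.
Proof. by move=> nij skS; rewrite /flip updE toggleK updK. Qed.

Lemma mCay_flip i j s S x y : i != j -> S \in skew ->
  mCay (flip i j s S) x y = mCay S x y (+)
    ([&& x.2 == i, y.2 == j & (y.1 * x.1^-1 == s)%g] ||
     [&& x.2 == j, y.2 == i & (x.1 * y.1^-1 == s)%g]).
Proof.
move=> nij /skewP[SV _]; rewrite !mCayE mxE.
have [->|_] := eqVneq x.2 i; have [->|_] := eqVneq y.2 j;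
  rewrite ?(negPf nij) ?[j == i]eq_sym ?(negPf nij) ?andbF /= ?orbF ?addbF //.
  by rewrite inE.
have [->|_] := eqVneq x.2 j; have [->|_] := eqVneq y.2 i;
  rewrite /= ?addbF //.
by rewrite (SV i j) !mem_invg invMg invgK inE.
Qed.

(** [flip] is an involution of the skew matrices that reverses every sign, so the sum equals its
    opposite. *)
Lemma sum_sign_flip (h : 'M[{set gT}]_m -> bool) i j s : i != j ->
  (forall S, S \in skew -> h (flip i j s S) = ~~ h S) ->
  \sum_(S in skew) (-1) ^+ h S = 0 :> int.
Proof.
move=> nij hN; pose U := \sum_(S in skew) ((-1) ^+ h S : int).
suff UN : U = - U by rewrite -/U; lia.
rewrite {1}/U (reindex_onto (flip i j s) (flip i j s)); last exact: (fun _ => @flipK _ _ _ _ _).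
rewrite -sumrN (eq_bigl (fun S => S \in skew)) => [|S].
  by apply: eq_bigr => S skS; rewrite hN // signrN.
apply/andP/idP => [[skS /eqP <-]|skS]; first exact: flip_skew.
by rewrite flip_skew ?flipK.
Qed.

Definition agreement S x y : int :=
  \sum_z (-1) ^+ (mCay S x z (+) mCay S y z).

Definition noise S x y : int := agreement S x y - (n * (x.2 == y.2))%:Z.

(** The vertices [z] in a common part of [x] and [y] are adjacent to neither, and contribute exactly
    the [n] subtracted in [noise]. *)
Lemma noiseE S x y : S \in skew -> noise S x y =
  \sum_(z | ~~ ((z.2 == x.2) && (z.2 == y.2))) (-1) ^+ (mCay S x z (+) mCay S y z).
Proof.
move=> skS; rewrite /noise /agreement.
rewrite (bigID (fun z => (z.2 == x.2) && (z.2 == y.2))) /= addrAC.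
rewrite [X in X - _](_ : _ = (n * (x.2 == y.2))%:Z) ?subrr ?add0r //.
have [exy|nxy] := eqVneq x.2 y.2; last first.
  rewrite muln0 big_pred0 // => z; apply/negbTE; apply: contra nxy.
  by case/andP => /eqP <-.
rewrite muln1 (eq_bigr (fun=> 1)) => [|z /andP[/eqP zx /eqP zy]]; last first.
  by rewrite !mCay_part.
rewrite sumr_const -[in RHS](card_imset _ (_ : injective (fun g : gT => (g, x.2)))).
  rewrite natz; congr (Posz _); apply: eq_card => -[g k]; rewrite unfold_in /= -exy andbb.
  apply/eqP/imsetP => [->|[h _ [_ ->] //]]; by exists g.
by move=> g h [].
Qed.

(** Flipping the edge {x, z} toggles its whole orbit under translations. This reverses the sign
    unless {x, z'} or {y, z'} lies in that orbit, which confines z' to the three vertices of [B];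
    the pair {y, z} never does, because x and y differ. *)
Lemma sum_sign_cross (P : pred (gT * 'I_m)) x y z : x != y -> z.2 != x.2 ->
  \sum_(z' | P z') \sum_(S in skew)
    (-1) ^+ (mCay S x z (+) mCay S y z (+) (mCay S x z' (+) mCay S y z'))
  <= 3 * #|skew|%:Z :> int.
Proof.
move=> nxy nzx; pose s := (z.1 * x.1^-1)%g.
pose B := [:: z; ((s * y.1)%g, z.2); ((s^-1 * y.1)%g, x.2)].
apply: (@le_trans _ _ (\sum_(z' in B) #|skew|%:Z)); last first.
  rewrite sumr_const -[leLHS]mulr_natl ler_wpM2r // ler_nat.
  exact: leq_trans (card_size B) _.
rewrite big_mkcond [X in _ <= X]big_mkcond; apply: ler_sum => z' _.
case: ifP => [_|_]; last by case: ifP.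
case: ifP => [_|/negbT z'B].
  apply: (@le_trans _ _ (\sum_(S in skew) 1)); last by rewrite sumr_const natz.
  by apply: ler_sum => S _; case: (_ (+) _).
rewrite le_eqVlt; apply/orP; left; apply/eqP.
apply: (@sum_sign_flip _ x.2 z.2 s); first by rewrite eq_sym.
move: z'B; rewrite !inE !negb_or => /and3P[nz'z nz'1 nz'2].
have yz : (y.2 == x.2) && (z.1 * y.1^-1 == s)%g = false.
  apply/negP => /andP[/eqP e2 /eqP/mulgI/invg_inj e1].
  by case/eqP: nxy; case: (x) (y) e1 e2 => [? ?] [? ?] /= -> ->.
have xz' : (z'.2 == z.2) && (z'.1 * x.1^-1 == s)%g = false.
  apply/negP => /andP[/eqP e2 /eqP/mulIg e1].
  by case/eqP: nz'z; case: (z) (z') e1 e2 => [? ?] [? ?] /= -> ->.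
have yz'1 : (z'.2 == z.2) && (z'.1 * y.1^-1 == s)%g = false.
  apply/negP => /andP[/eqP e2 /eqP e1].
  by case/eqP: nz'1; rewrite -e1 mulgKV -e2; case: (z').
have yz'2 : (z'.2 == x.2) && (y.1 * z'.1^-1 == s)%g = false.
  apply/negP => /andP[/eqP e2 /eqP e1].
  by case/eqP: nz'2; rewrite -e1 invMg invgK mulgKV -e2; case: (z').
move=> S skS; rewrite !mCay_flip 1?eq_sym // !eqxx /= ?(negPf nzx) /=.
rewrite yz xz' yz'1 yz'2 [x.2 == _]eq_sym (negPf nzx) !andbF !addbF.
by rewrite addbT !addNb.
Qed.

(** In the expanded square, every [z] avoids the part of [x] or that of [y], so by symmetry it
    correlates with at most three z'. *)
Lemma second_moment x y : x != y ->
  \sum_(S in skew) noise S x y ^+ 2 <= 3 * (n * m)%:Z * #|skew|%:Z.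
Proof.
move=> nxy; pose P z := ~~ ((z.2 == x.2) && (z.2 == y.2)).
pose a S z := mCay S x z (+) mCay S y z.
have -> : \sum_(S in skew) noise S x y ^+ 2 =
    \sum_(z | P z) \sum_(z' | P z') \sum_(S in skew) ((-1) ^+ (a S z (+) a S z') : int).
  under eq_bigr => S skS do rewrite noiseE // expr2 big_distrlr /=.
  rewrite exchange_big; apply: eq_bigr => z _.
  rewrite exchange_big; apply: eq_bigr => z' _.
  by apply: eq_bigr => S _; rewrite -signr_addb.
apply: (@le_trans _ _ (\sum_(z | P z) 3 * #|skew|%:Z)).
  apply: ler_sum => z; rewrite /P negb_and => /orP[nzx|nzy].
    exact: sum_sign_cross.
  rewrite /a; under eq_bigr => z' _ do under eq_bigr => S _ do
    rewrite [mCay S x z (+) _]addbC [mCay S x z' (+) _]addbC.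
  by apply: sum_sign_cross; rewrite // eq_sym.
rewrite big_mkcond /=.
apply: (@le_trans _ _ (\sum_(z : gT * 'I_m) (3 * #|skew|%:Z))).
  by apply: ler_sum => z _; case: ifP => // _; rewrite mulr_ge0.
by rewrite sumr_const -[leLHS]mulr_natr card_prod card_ord mulrAC !natz.
Qed.

Definition deviating S x : {set gT * 'I_m} :=
  [set y | (y != x) && (n%:Z <= 2 * `|noise S x y|)].

(** Chebyshev: a deviating [y] has n^2 <= 4 noise^2, and the second moment is then summed over at
    most (nm)^2 pairs. *)
Lemma sum_deviating :
  (\sum_(S in skew) \sum_x #|deviating S x| * n ^ 2 <= 12 * (n * m) ^ 3 * #|skew|)%N.
Proof.
pose V : finType := (gT * 'I_m)%type.
have dev S x : (#|deviating S x| * n ^ 2)%:Z <=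
    \sum_(y | y != x) 4 * noise S x y ^+ 2.
  rewrite -sum1_card big_distrl /= (big_morph Posz (id1 := 0) PoszD) //.
  rewrite big_mkcond [X in _ <= X]big_mkcond; apply: ler_sum => y _; rewrite inE.
  case: ifP => [/andP[-> le]|_]; last by case: ifP => // _; rewrite mulr_ge0 ?sqr_ge0.
  rewrite mul1n -[noise S x y ^+ 2]real_normK ?num_real //.
  have /= := @ler_pM int _ _ _ _ _ _ le le; rewrite !expr2; nia.
have -> : (12 * (n * m) ^ 3 * #|skew| = #|V| * (#|V| * (4 * (3 * (n * m) * #|skew|))))%N.
  by rewrite card_prod card_ord; move: (n * m)%N => N; rewrite !expnS expn0; nia.
rewrite -lez_nat (big_morph Posz (id1 := 0) PoszD) //.
apply: (@le_trans _ _ (\sum_(S in skew) \sum_x \sum_(y | y != x) 4 * noise S x y ^+ 2)).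
  apply: ler_sum => S _; rewrite (big_morph Posz (id1 := 0) PoszD) //.
  by apply: ler_sum => x _; exact: dev.
have cst (C : nat) : (#|V| * C)%:Z = \sum_(x : V) C%:Z.
  by rewrite sumr_const -mulr_natl natz.
rewrite exchange_big /= cst; apply: ler_sum => x _; rewrite exchange_big /= cst.
rewrite big_mkcond /=; apply: ler_sum => y _; case: ifP => // nyx.
rewrite -mulr_sumr PoszM ler_wpM2l // !PoszM; apply: le_trans (second_moment _) _.
  by rewrite eq_sym.
by rewrite !PoszM.
Qed.

Lemma agreement_aut S (f : {perm gT * 'I_m}) x y :
  f \in graph_aut (mCay S) -> agreement S (f x) (f y) = agreement S x y.
Proof.
move=> /graph_autP fA; rewrite /agreement (reindex_inj (@perm_inj _ f)) /=.
by apply: eq_bigr => z _; rewrite !fA.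
Qed.

Lemma deviating_trans S x h : #|deviating S (trans m h x)| = #|deviating S x|.
Proof.
rewrite -(card_imset (deviating S x) (@perm_inj _ (trans m h))).
apply/esym/eq_card => y; apply/imsetP/idP => [[z + ->]|].
  by rewrite !inE /noise agreement_aut ?trans_aut // (inj_eq perm_inj) !transE.
move=> yD; exists ((trans m h)^-1%g y); last by rewrite permKV.
move: yD; rewrite -{1}(permKV (trans m h) y); set z := _ y.
by rewrite !inE /noise agreement_aut ?trans_aut // (inj_eq perm_inj) !transE.
Qed.

Definition rough_matrices : {set 'M[{set gT}]_m} :=
  [set S in skew | [exists x, (n <= 8 * #|deviating S x|)%N]].

(** Translations are automorphisms, so one bad vertex yields [n] bad ones. Averaging over vertices
    thus gains a factor [n] over a union bound; the constant is 8 * 12. *)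
Lemma card_rough : (#|rough_matrices| * n <= 96 * m ^ 3 * #|skew|)%N.
Proof.
have n_gt0 : (0 < n)%N by apply/card_gt0P; exists 1%g.
have rough S : S \in rough_matrices ->
    (n ^ 2 <= 8 * \sum_x #|deviating S x|)%N.
  rewrite inE => /andP[_ /existsP[x le]].
  have inj_tr : injective (fun h => trans m h x).
    by move=> h k; rewrite !transE => -[/mulgI].
  apply: (@leq_trans (8 * \sum_(y in [set trans m h x | h in gT]) #|deviating S y|)).
    rewrite big_imset /=; last exact: in2W.
    under eq_bigr do rewrite deviating_trans.
    by rewrite sum_nat_const mulnCA -mulnn leq_mul2l le orbT.
  rewrite leq_mul2l /= [X in (_ <= X)%N](bigID (mem [set trans m h x | h in gT])).
  exact: leq_addr.
rewrite -(leq_pmul2r (_ : 0 < n ^ 3)%N) ?expn_gt0 ?n_gt0 //.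
have := sum_deviating; under eq_bigr do rewrite -big_distrl /=.
rewrite -big_distrl /= => dev.
have : (#|rough_matrices| * n ^ 2 <= 8 * \sum_(S in skew) \sum_x #|deviating S x|)%N.
  rewrite -sum_nat_const big_distrr /= big_mkcond [X in (_ <= X)%N]big_mkcond.
  apply: leq_sum => S _; case: ifP => // Sr; have := rough S Sr.
  by move: Sr; rewrite inE => /andP[->].
move=> le1; have := leq_mul le1 (leqnn (n ^ 2)); move: dev.
set X := (\sum_(S in _) _)%N; rewrite !expnMn; set K := #|skew|.
move=> dev le2; apply: (@leq_trans (8 * X * n ^ 2)).
  by apply: leq_trans le2; rewrite !expnS expn0 !muln1 -!mulnA.
move: dev; move: (n ^ 3)%N (n ^ 2)%N (m ^ 3)%N => a b c; nia.
Qed.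

Lemma aut_parts S (f : {perm gT * 'I_m}) x y :
  S \in skew -> S \notin rough_matrices -> f \in graph_aut (mCay S) ->
  x.2 = y.2 -> (f x).2 = (f y).2.
Proof.
move=> skS; rewrite inE skS /= negb_exists => /forallP smooth fA exy.
have n_gt0 : (0 < n)%N by apply/card_gt0P; exists 1%g.
(* [N u] is preserved by automorphisms and is the part of [u] up to deviating vertices. Two such
   sets share more than 3n/4 vertices if the parts are equal and fewer than n/4 otherwise. *)
pose N u := [set v | n%:Z < 2 * agreement S u v].
have NP u v : v \notin deviating S u -> (v \in N u) = (v.2 == u.2).
  have [-> _|nvu] := eqVneq v u.
    rewrite inE eqxx /agreement (eq_bigr (fun=> 1)) => [|z _]; last by rewrite addbb.
    rewrite sumr_const card_prod card_ord !natz.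
    have aux (a b : nat) : (0 < a)%N -> (0 < b)%N -> a%:Z < 2 * (a * b)%:Z by nia.
    exact: aux n_gt0 (leq_ltn_trans (leq0n _) (ltn_ord u.2)).
  rewrite !inE nvu /= -ltNge /noise [u.2 == _]eq_sym.
  have aux (a : int) (b : nat) (c : bool) :
      2 * `|a - (b * c)%:Z| < b%:Z -> (b%:Z < 2 * a) = c by case: c; lia.
  exact: aux.
have small u : (8 * #|deviating S u| < n)%N by have := smooth u; rewrite -ltnNge.
have cardN u v : #|N (f u) :&: N (f v)| = #|N u :&: N v|.
  rewrite -(card_imset (N u :&: N v) (@perm_inj _ f)); apply: eq_card => z.
  apply/idP/imsetP => [|[w + ->]]; last by rewrite !inE !agreement_aut.
  move=> zN; exists (f^-1%g z); last by rewrite permKV.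
  by move: zN; rewrite !inE -{1 2}(permKV f z) !agreement_aut.
apply/eqP/negPn/negP => nfxy.
have upper : (#|N x :&: N y| <= #|deviating S (f x)| + #|deviating S (f y)|)%N.
  rewrite -cardN -cardsUI; apply: leq_trans (leq_addr _ _).
  apply/subset_leq_card/subsetP => z; rewrite in_setI in_setU => /andP[zx zy].
  apply/negPn/negP; rewrite negb_or => /andP[/NP ex /NP ey].
  by move: nfxy; rewrite -(eqP (etrans (esym ex) zx)) -(eqP (etrans (esym ey) zy)) eqxx.
have lower : (n <= #|N x :&: N y| + (#|deviating S x| + #|deviating S y|))%N.
  rewrite -[X in (X <= _)%N](card_imset _ (_ : injective (fun g : gT => (g, x.2)))).
    apply: leq_trans (_ : _ <= #|N x :&: N y| + #|deviating S x :|: deviating S y|)%N _; last first.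
      by rewrite leq_add2l -cardsUI leq_addr.
    rewrite -cardsUI; apply: leq_trans (leq_addr _ _).
    apply/subset_leq_card/subsetP => _ /imsetP[g _ ->]; rewrite !in_setU !in_setI.
    have [//|/NP ->] := boolP (_ \in deviating S x); first by rewrite !orbT.
    have [//|/NP ->] := boolP (_ \in deviating S y); first by rewrite !orbT.
    by rewrite /= exy eqxx.
  by move=> g h [].
have := small x; have := small y; have := small (f x); have := small (f y); lia.
Qed.

End SecondMoment.

(** * Automorphisms and a separating base *)

(** Quotients s t^-1 of elements of [T] lie in the subgroup [H] of left translations commuting with
    [f2]. Having more than n/2 elements, [H] is the whole group, so [f2] is a right translation, and
    any [t] in [T] transfers this to [f1]. *)
Lemma equivariant_coset (gT : finGroupType) (f1 f2 : gT -> gT) :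
  (#|gT| < 2 * #|[set s : gT | [forall g, f2 (s * g)%g == (s * f1 g)%g]]|)%N ->
  exists h, (forall g, f1 g = g * h) /\ (forall g, f2 g = g * h).
Proof.
set T := [set s | _] => ltT.
have memT s : s \in T -> forall g, f2 (s * g) = s * f1 g.
  by rewrite inE => /'forall_eqP.
pose H := [set u : gT | [forall g, f2 (u * g) == u * f2 g]].
have gH : group_set H.
  apply/group_setP; split=> [|a b].
    by rewrite inE; apply/'forall_eqP => g; rewrite !mul1g.
  rewrite !inE => /'forall_eqP Ha /'forall_eqP Hb; apply/'forall_eqP => g.
  by rewrite -!mulgA Ha Hb.
have /card_gt0P[t tT] : (0 < #|T|)%N by lia.
have leTH : (#|T| <= #|H|)%N.
  rewrite -(card_imset _ (mulIg t^-1)); apply/subset_leq_card/subsetP.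
  move=> _ /imsetP[s sT ->]; rewrite inE; apply/'forall_eqP => g.
  rewrite -mulgA memT // -mulgA; congr (_ * _); apply: (mulgI t).
  by rewrite -memT // !mulKVg.
have HT : H = setT.
  apply/eqP; rewrite eqEcard subsetT cardsT /=.
  have := cardSg (subsetT (Group gH)); rewrite cardsT /= => /dvdnP[q nq].
  have aux (a b c : nat) : (0 < a -> a = c * b -> a < 2 * b -> a <= b)%N.
    by case: c => [|[|c]]; nia.
  apply: aux nq (leq_trans ltT (leq_mul (leqnn 2) leTH)).
  by apply/card_gt0P; exists 1.
have f2E g : f2 g = g * f2 1.
  have : g \in H by rewrite HT inE.
  by rewrite inE => /'forall_eqP/(_ 1); rewrite mulg1.
exists (f2 1); split=> // g; apply: (mulgI t).
by rewrite -memT // f2E mulgA.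
Qed.

Section Base.
Variables (gT : finGroupType) (m k : nat) (v : 'I_k -> gT).
Hypothesis inj_v : injective v.
Implicit Type (S : 'M[{set gT}]_m) (i j b c : 'I_m) (f : {perm gT * 'I_m}).
Local Notation n := #|gT|.
Local Notation skew := (skew_matrices gT m).

Definition confusing (d : 'I_m * 'I_m * (gT * gT)) : {set 'M[{set gT}]_m} :=
  [set S in skew | [&& d.1.1 != d.1.2, d.2.1 != d.2.2 &
    [forall l, mCay S (v l, d.1.1) (d.2.1, d.1.2) ==
               mCay S (v l, d.1.1) (d.2.2, d.1.2)]]].

Definition unresolved : {set 'M[{set gT}]_m} := [set S | [exists d, S \in confusing d]].

Lemma resolvedP S b j g h : S \in skew -> S \notin unresolved -> b != j ->
  (forall l, mCay S (v l, b) (g, j) = mCay S (v l, b) (h, j)) -> g = h.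
Proof.
move=> skS; rewrite inE negb_exists => /forallP/(_ (b, j, (g, h))).
rewrite inE skS /= => + nbj eq_gh; rewrite nbj /=; case: eqVneq => //= _ /negP[].
by apply/forallP => l; apply/eqP.
Qed.

(** If (g, j) and (h, j) are confused, the entry (b, j) is constant on the pairs {s, h g^-1 s} with
    s = g v_l^-1, and these [k] values of s are distinct. *)
Lemma card_unresolved :
  (#|unresolved| * 2 ^ uphalf k <= m ^ 2 * n ^ 2 * #|skew|)%N.
Proof.
have -> : (m ^ 2 * n ^ 2 = #|{: 'I_m * 'I_m * (gT * gT)}|)%N.
  by rewrite !card_prod !card_ord -!mulnn.
apply: (union_bound (F := confusing)) => [S|[[b j] [g h]]].
  by rewrite inE => /existsP.
have [->|nbj] := eqVneq b j.
  by rewrite (_ : confusing _ = set0) ?cards0 //; apply/setP => S; rewrite !inE eqxx andbF.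
have [->|ngh] := eqVneq g h.
  by rewrite (_ : confusing _ = set0) ?cards0 //; apply/setP => S; rewrite !inE eqxx /= !andbF.
apply: (@card_fiber _ _ _ b j) => // [|S skS].
  by apply/subsetP => S; rewrite inE => /andP[].
pose M := [set g * (v l)^-1 | l : 'I_k].
have cM : #|M| = k.
  by rewrite card_imset ?card_ord // => l l' /mulgI/invg_inj/inj_v.
have /card_constant_pairs : forall s, s \in M -> h * g^-1 * s != s.
  move=> s _; rewrite -{2}[s]mul1g (inj_eq (mulIg s)) -(mulgV g) (inj_eq (mulIg _)).
  by rewrite eq_sym.
rewrite cM; apply: leq_trans; rewrite leq_mul2r; apply/orP; right.
apply/subset_leq_card/subsetP => A; rewrite !in_set => /andP[_ /= /and3P[_ _ /forallP AP]].
apply/'forall_implyP => _ /imsetP[l _ ->].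
by have := AP l; rewrite !mCayE /= !updE mulgA mulgKV.
Qed.

(** Since [f] maps part [j] onto part [c], f'(g, j) is some f(h, j). Pulled back by f' and by f, its
    adjacencies to the images of the base show that g and h have the same adjacencies to the base.
    Two matrices occur because the lemma compares resamplings of one entry. *)
Lemma aut_determined S S' f f' b j c :
  S \in skew -> S \notin unresolved -> b != j ->
  f \in graph_aut (mCay S) -> f' \in graph_aut (mCay S') ->
  (forall l g, mCay S' (v l, b) (g, j) = mCay S (v l, b) (g, j)) ->
  (forall l y, y.2 = c -> mCay S' (f (v l, b)) y = mCay S (f (v l, b)) y) ->
  (forall l, f' (v l, b) = f (v l, b)) ->
  (forall g, (f (g, j)).2 = c) -> (forall g, (f' (g, j)).2 = c) ->
  forall g, f' (g, j) = f (g, j).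
Proof.
move=> skS resS nbj /graph_autP fA /graph_autP fA' eqb eqc eqf fc fc' g.
have inj1 : injective (fun g => (f (g, j)).1).
  move=> a a' /= e1; have /perm_inj[] // : f (a, j) = f (a', j).
  by rewrite [LHS]surjective_pairing [RHS]surjective_pairing e1 !fc.
have /codomP[h fh] := injF_onto inj1 (f' (g, j)).1.
have e : f' (g, j) = f (h, j).
  by rewrite [LHS]surjective_pairing [RHS]surjective_pairing fh fc fc'.
rewrite e; congr (f (_, j)); apply: (resolvedP skS resS nbj) => l.
by rewrite -fA -eqc ?fc // -e -eqf fA' eqb.
Qed.

Definition moving (d : 'I_m * 'I_m * 'I_m * {ffun 'I_k -> gT * 'I_m} * (gT * 'I_m)) :
    {set 'M[{set gT}]_m} :=
  let: (j, b, i, w, z) := d in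
  [set S in skew | [&& S \notin unresolved, b != j, i != j, i != b &
    [exists f : {perm gT * 'I_m}, [&& f \in graph_aut (mCay S),
      [forall l, f (v l, b) == w l], f (1, i) == z & [forall g, (f (g, j)).2 == b]]]]].

(* The entry (i, j) is a function of the other entries and of d: the rows b and
   b^f already determine f on the part j, and f carries the pair of parts
   (i, j) to a pair that meets b, hence is not the pair (i, j) itself. *)
Lemma card_moving d : (#|moving d| * 2 ^ n <= #|skew|)%N.
Proof.
case: d => [[[[j b] i] w] z].
have [->|nij] := eqVneq i j.
  by rewrite /= (_ : [set _ in _ | _] = set0) ?cards0 //; apply/setP => S;
     rewrite !inE eqxx /= !andbF.
apply: (@card_fiber _ _ _ i j) => // [|S skS].
  by apply/subsetP => S; rewrite inE => /andP[].
rewrite -{2}[(2 ^ n)%N]mul1n leq_mul2r; apply/orP; right.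
apply/card_le1_eqP => A A'.
rewrite in_set /moving => /setIdP[skA /and5P[resA nbj _ nib /existsP[f]]].
move=> /and4P[fA /'forall_eqP fw /eqP fz /'forall_eqP fb].
rewrite in_set => /setIdP[skA' /and5P[resA' _ _ _ /existsP[f']]].
move=> /and4P[fA' /'forall_eqP fw' /eqP fz' /'forall_eqP fb'].
have eqb x y : y.2 = b -> mCay (upd S i j A') x y = mCay (upd S i j A) x y.
  by move=> yb; rewrite !mCay_upd // yb ?(negPf nbj) ?[b == i]eq_sym ?(negPf nib) ?andbF.
have ff' : forall g, f' (g, j) = f (g, j).
  apply: (@aut_determined (upd S i j A) (upd S i j A') f f' b j b) => //.
  - by move=> l g; rewrite mCay_sym // [RHS]mCay_sym // eqb.
  - by move=> l y yb; rewrite eqb.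
  - by move=> l; rewrite fw fw'.
(* The entry (i, j) is read off as the neighbourhood of (1, i) in part [j]. *)
apply/setP => s; have e (B : {set gT}) : s \in B = mCay (upd S i j B) (1, i) (s, j).
  by rewrite mCayE /= updE invg1 mulg1.
rewrite !e -(graph_autP _ _ fA) -(graph_autP _ _ fA') ff' fz fz'.
by rewrite -eqb // fb.
Qed.

Definition untranslated (p0 : 'I_m) (w : {ffun 'I_k -> gT * 'I_m}) :
    {set 'M[{set gT}]_m} :=
  [set S in skew | (S \notin unresolved) &&
    [exists f : {perm gT * 'I_m}, [&& f \in graph_aut (mCay S),
      [forall x, (f x).2 == x.2], [forall h, f != trans m h] &
      [forall l, f (v l, p0) == w l]]]].

(** One member [A0] of the fiber supplies a reference automorphism [f0]. Every other member has an
    automorphism with the same base images, hence equal to [f0] on [p1] and [p2], so its entry is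
    invariant under the moves of [f0]. *)
Lemma card_untranslated p0 p1 p2 w : p0 != p1 -> p0 != p2 -> p1 != p2 ->
  (#|untranslated p0 w| * 2 ^ (n %/ 4) <= #|skew|)%N.
Proof.
move=> n01 n02 n12; apply: (@card_fiber _ _ _ p1 p2) => // [|S skS].
  by apply/subsetP => S; rewrite inE => /andP[].
set X := [set A | _]; have [->|/set0Pn[A0]] := eqVneq X set0; first by rewrite cards0.
rewrite in_set => /setIdP[skA0 /andP[resA0 /existsP[f0]]].
move=> /and4P[f0A /'forall_eqP f0p /forallP f0tr /'forall_eqP f0w].
pose f1 g := (f0 (g, p1)).1; pose f2 g := (f0 (g, p2)).1.
have f1E g : f0 (g, p1) = (f1 g, p1) by rewrite [LHS]surjective_pairing f0p.
have f2E g : f0 (g, p2) = (f2 g, p2) by rewrite [LHS]surjective_pairing f0p.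
pose T := [set s : gT | [forall g, f2 (s * g) == s * f1 g]].
(* [q] selects one move displacing [s]; the default [s] occurs only on [T], where all moves fix
   [s]. *)
pose q s := odflt s (omap (fun g => f2 (s * g) * (f1 g)^-1)
                          [pick g | f2 (s * g) * (f1 g)^-1 != s]).
have qT s : s \in ~: T -> q s != s.
  rewrite !inE negb_forall => /existsP[g ng]; rewrite /q.
  case: pickP => [h //|/(_ g)/negbT/negPn/eqP e].
  by case/eqP: ng; rewrite -[RHS](congr1 (fun u => u * f1 g) e) mulgKV.
(* Otherwise [f0] acts on [p1] as a translation. Undoing it fixes [p1] pointwise, and the base in
   [p1] separates the vertices of every other part, so [f0] is that translation everywhere. *)
have leT : (2 * #|T| <= n)%N.
  rewrite leqNgt; apply/negP => /equivariant_coset[h [tr1 tr2]].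
  case/negP: (f0tr h); apply/eqP/permP => -[g c]; rewrite transE /=.
  have [->|ncp] := eqVneq c p1; first by rewrite f1E tr1.
  pose f3 := f0 * (trans m h)^-1.
  have f3A : f3 \in graph_aut (mCay (upd S p1 p2 A0)).
    by rewrite groupM ?groupV ?trans_aut.
  have f3E x : f3 x = ((f0 x).1 * h^-1, x.2).
    by rewrite permM; apply: (canLR (permK _)); rewrite transE /= mulgKV -f0p -surjective_pairing.
  suff e3 : (f3 (g, c)).1 = g.
    by rewrite -{2}e3 f3E /= mulgKV [LHS]surjective_pairing f0p.
  apply: (resolvedP skA0 resA0 (_ : p1 != c)) => [|l]; first by rewrite eq_sym.
  rewrite -[RHS](graph_autP _ _ f3A) !f3E f1E tr1 mulgK /=.
  by [].
have leX : X \subset constant_pairs q (~: T).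
  apply/subsetP => A; rewrite in_set => /setIdP[skA /andP[resA /existsP[f]]].
  move=> /and4P[fA /'forall_eqP fp _ /'forall_eqP fw].
  have eq0 B x y : x.2 = p0 -> mCay (upd S p1 p2 B) x y = mCay S x y.
    by move=> xp; rewrite mCay_upd // xp ?(negPf n01) ?(negPf n02).
  have det j : p0 != j -> forall g, f (g, j) = f0 (g, j).
    move=> n0j; apply: (@aut_determined (upd S p1 p2 A0) (upd S p1 p2 A) f0 f p0 j j) => //.
    - by move=> l g; rewrite !eq0.
    - by move=> l y _; rewrite !eq0 ?f0p.
    - by move=> l; rewrite fw f0w.
  rewrite inE; apply/'forall_implyP => s _; rewrite /q; case: pickP => //= g _.
  have := graph_autP _ _ fA (g, p1) (s * g, p2).
  by rewrite !det // f1E f2E !mCayE /= updE mulgK => ->.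
apply: leq_trans (card_constant_pairs qT).
apply: leq_mul; first exact: subset_leq_card.
have aux (a b c : nat) : (2 * a <= c -> a + b = c -> c %/ 4 <= uphalf b)%N by lia.
by rewrite leq_pexp2l // (aux _ _ _ leT) // cardsC.
Qed.

Lemma not_mPGSR_cases S p0 p1 p2 :
  p0 != p1 -> p0 != p2 -> p1 != p2 ->
  S \in skew -> S \notin mPGSR_matrices gT m ->
  [\/ S \in rough_matrices gT m, S \in unresolved,
      exists d, S \in moving d | exists w, S \in untranslated p0 w].
Proof.
move=> n01 n02 n12 skS; rewrite inE skS /= => nS.
have [rS|/aut_parts parts] := boolP (S \in rough_matrices gT m); first by constructor 1.
have [uS|resS] := boolP (S \in unresolved); first by constructor 2.
have m_gt0 : (0 < m)%N := leq_ltn_trans (leq0n _) (ltn_ord p0).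
have [f fA nf] : exists2 f, f \in graph_aut (mCay S) & forall h, f != trans m h.
  have [/existsP[f /andP[fA /forallP]]|nex] :=
    boolP [exists f : {perm gT * 'I_m}, (f \in graph_aut (mCay S)) && [forall h, f != trans m h]].
    by exists f.
  case/negP: nS; apply: mPGSR_of_trans => // f fA.
  move: nex; rewrite negb_exists => /forallP/(_ f); rewrite fA /= negb_forall.
  by case/existsP => h /negPn/eqP; exists h.
have [fp|] := boolP [forall x, (f x).2 == x.2].
  constructor 4; exists [ffun l => f (v l, p0)].
  rewrite in_set skS resS; apply/existsP; exists f; rewrite fA fp /=.
  by apply/andP; split; [apply/forallP | apply/'forall_eqP => l; rewrite ffunE].
rewrite negb_forall => /existsP[[g j] /= nfj]; set b := (f (g, j)).2 in nfj.
(* Three distinct parts cannot all lie in {j, b}. *)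
have [i nij nib] : exists2 i, i != j & i != b.
  have [e0|n0] := boolP (p0 \in [:: j; b]); last first.
    by move: n0; rewrite !inE negb_or => /andP[? ?]; exists p0.
  have [e1|n0] := boolP (p1 \in [:: j; b]); last first.
    by move: n0; rewrite !inE negb_or => /andP[? ?]; exists p1.
  exists p2; apply/eqP => e2; move: e0 e1 n01 n02 n12; rewrite !inE e2.
    by case: (eqVneq p0 j) => //= _ /eqP ->; case: (eqVneq p1 j) => //= _ /eqP ->; rewrite eqxx.
  by case: (eqVneq p0 b) => //=; rewrite ?orbF => _ /eqP ->;
     case: (eqVneq p1 b) => //=; rewrite ?orbF => _ /eqP ->; rewrite eqxx.
constructor 3; exists (j, b, i, [ffun l => f (v l, b)], f (1, i)).
rewrite /moving in_set skS resS nfj nij nib; apply/existsP; exists f.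
rewrite fA eqxx /=; apply/andP; split; first by apply/'forall_eqP => l; rewrite ffunE.
by apply/'forall_eqP => h; apply: parts.
Qed.

End Base.

(** * Adding up the exceptional proportions *)

(** Since 2^(L - 1) < n, it suffices to compare with 2^(L - 1), by induction from L = 16. The left
    side is four times the exponent 16 L^2 + 6 L of the union bound over base images. *)
Lemma quadratic_log_bound n : (2 ^ 16 <= n)%N ->
  (64 * up_log 2 n ^ 2 + 24 * up_log 2 n <= n)%N.
Proof.
set L := up_log 2 n => le_n.
have n_gt1 : (1 < n)%N by apply: leq_trans le_n.
have /andP[ltL _] := up_log_bounds (isT : 1 < 2)%N n_gt1.
have geL : (16 <= L)%N.
  rewrite -(leq_exp2l _ _ (isT : 1 < 2)%N).
  exact: leq_trans le_n (up_logP _ _).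
apply: leq_trans (ltnW ltL); rewrite -/L -(subnK geL).
elim: (L - 16)%N => [|d IHd]; first by rewrite !expnS !expn0; lia.
have -> : (d.+1 + 16).-1 = (d + 16).-1.+1 by lia.
rewrite [X in (_ <= X)%N]expnS; move: IHd; rewrite -!mulnn; move: (2 ^ _)%N => E; nia.
Qed.

Section Count.
Variables (gT : finGroupType) (m : nat).
Local Notation n := #|gT|.
Local Notation skew := (skew_matrices gT m).
Local Open Scope nat_scope.

Lemma card_not_mPGSR : 3 <= m -> m <= n -> 2 ^ 16 <= n ->
  #|skew :\: mPGSR_matrices gT m| * n <= 100 * m ^ 3 * #|skew|.
Proof.
move=> m_ge3 le_mn le_n; pose L := up_log 2 n.
have n_gt0 : 0 < n by apply: leq_trans le_n.
have le_nL : n <= 2 ^ L by apply: up_logP.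
have logn := quadratic_log_bound le_n; rewrite -/L in logn.
have [v inj_v] : exists v : 'I_(8 * L) -> gT, injective v.
  have le_kn : 8 * L <= n by apply: leq_trans logn; nia.
  exists (fun l => enum_val (widen_ord le_kn l)) => l l' /enum_val_inj/(congr1 val) /= e.
  exact: val_inj.
have [p0 [p1 [p2 [n01 n02 n12]]]] :
    exists p0 p1 p2 : 'I_m, [/\ p0 != p1, p0 != p2 & p1 != p2].
  by exists (Ordinal (ltnW (ltnW m_ge3))), (Ordinal (ltnW m_ge3)), (Ordinal m_ge3).
pose q := n %/ 4.
have le_q : 16 * L ^ 2 + 6 * L <= q by rewrite leq_divRL //; lia.
(* This one estimate serves both families: with m <= n <= 2^L, the left side is at most 2 to the
   power L + 3 L + 2 L (8 L + 1). *)
have lePow : n * m ^ 3 * (n * m) ^ (8 * L).+1 <= 2 ^ q.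
  apply: leq_trans (leq_pexp2l (isT : 0 < 2) le_q).
  have le_mL := leq_trans le_mn le_nL.
  have -> : 16 * L ^ 2 + 6 * L = L + L * 3 + (L + L) * (8 * L).+1.
    by rewrite -mulnn; lia.
  rewrite !expnD 2!expnM; apply: leq_mul; last first.
    by rewrite leq_exp2r // expnD leq_mul.
  by rewrite leq_mul // leq_exp2r.
pose R3 : {set 'M[{set gT}]_m} := [set S | [exists d, S \in moving v d]].
pose R4 := [set S | [exists w, S \in untranslated v p0 w]].
have c1 := card_rough gT m; have c2 := card_unresolved m inj_v.
have c3 : #|R3| * 2 ^ n <= m ^ 3 * (n * m) ^ (8 * L).+1 * #|skew|.
  rewrite (_ : m ^ 3 * _ = #|{: 'I_m * 'I_m * 'I_m * {ffun 'I_(8 * L) -> gT * 'I_m} * (gT * 'I_m)}|).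
    apply: (union_bound (F := moving v)) => [S|d]; first by rewrite inE => /existsP.
    exact: card_moving.
  rewrite !card_prod card_ffun !card_prod !card_ord [(n * m) ^ _]expnSr mulnA.
  by rewrite !expnSr expn0 mul1n.
have c4 : #|R4| * 2 ^ q <= (n * m) ^ (8 * L) * #|skew|.
  rewrite (_ : (n * m) ^ _ = #|{ffun 'I_(8 * L) -> gT * 'I_m}|).
    apply: (union_bound (F := untranslated v p0)) => [S|w]; first by rewrite inE => /existsP.
    exact: card_untranslated n01 n02 n12.
  by rewrite card_ffun card_prod !card_ord.
have d2 : #|unresolved m v| * n <= m ^ 2 * #|skew|.
  rewrite -(leq_pmul2r (_ : 0 < n ^ 2)) ?expn_gt0 ?n_gt0 //.
  (* The base size 8 L makes the gain 2^(4 L) at least n^4, which covers the n^3 required. *)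
  apply: leq_trans (_ : #|unresolved m v| * 2 ^ uphalf (8 * L) <= _).
    rewrite -mulnA leq_mul2l -expnS; apply/orP; right.
    have -> : uphalf (8 * L) = L * 4 by lia.
    rewrite expnM; apply: (@leq_trans (n ^ 4)); last by rewrite leq_exp2r.
    exact: leq_pexp2l.
  by rewrite mulnAC.
have d3 : #|R3| * n <= #|skew|.
  rewrite -(leq_pmul2r (_ : 0 < 2 ^ n)) ?expn_gt0 //.
  rewrite mulnAC; apply: leq_trans (leq_mul c3 (leqnn n)) _.
  rewrite mulnAC mulnC leq_mul2l; apply/orP; right.
  rewrite mulnC mulnA; apply: leq_trans lePow _.
  by rewrite leq_pexp2l // leq_div.
have d4 : #|R4| * n <= #|skew|.
  rewrite -(leq_pmul2r (_ : 0 < 2 ^ q)) ?expn_gt0 //.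
  rewrite mulnAC; apply: leq_trans (leq_mul c4 (leqnn n)) _.
  rewrite mulnAC mulnC leq_mul2l; apply/orP; right; apply: leq_trans lePow.
  rewrite mulnC -mulnA leq_mul2l [(n * m) ^ _.+1]expnS mulnA; apply/orP; right.
  by rewrite leq_pmull // muln_gt0 expn_gt0 muln_gt0 n_gt0 (ltnW (ltnW m_ge3)).
have cover : #|skew :\: mPGSR_matrices gT m| <=
    #|rough_matrices gT m| + #|unresolved m v| + #|R3| + #|R4|.
  have leU (T : finType) (A B : {set T}) : #|A :|: B| <= #|A| + #|B|.
    by rewrite -cardsUI leq_addr.
  apply: (@leq_trans #|rough_matrices gT m :|: unresolved m v :|: R3 :|: R4|).
    apply/subset_leq_card/subsetP => S /setDP[skS nS]; rewrite !in_setU.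
    have [->|->|[d Sd]|[w Sw]] := not_mPGSR_cases v n01 n02 n12 skS nS; rewrite ?orbT //.
      by rewrite (_ : S \in R3) ?orbT // inE; apply/existsP; exists d.
    by rewrite (_ : S \in R4) ?orbT // inE; apply/existsP; exists w.
  do 2!(apply: leq_trans (leU _ _ _) _ => //; rewrite leq_add2r); exact: leU.
apply: leq_trans (leq_mul cover (leqnn n)) _; rewrite !mulnDl.
(* The four contributions total 96 m^3 + m^2 + 2, below 100 m^3. *)
have m2 : m ^ 2 <= m ^ 3 by rewrite leq_pexp2l // (leq_trans _ m_ge3).
have m3 : 0 < m ^ 3 by rewrite expn_gt0 (leq_trans _ m_ge3).
move: c1 d2 d3 d4 m2 m3.
move: (#|rough_matrices gT m| * n) (#|unresolved m v| * n) (#|R3| * n) (#|R4| * n) (m ^ 2) (m ^ 3) #|skew|.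
move=> a b c d e f K; nia.
Qed.
End Count.

Local Open Scope ring_scope.

Theorem theorem1p8 (m : nat) (hm : (3 <= m)%N) :
  exists N : nat, forall (R : rcfType) (gT : finGroupType), (N <= #|gT|)%N ->
    1 - m%:R ^+ 2 / Num.sqrt #|gT|%:R < mPGSR_proportion R gT m.
Proof.
(* The second bound gives sqrt n >= 101 m, hence 100 m^3 / n < m^2 / sqrt n; it also ensures m <=
   n. *)
exists (maxn (2 ^ 16) ((101 * m) ^ 2)) => R gT; rewrite geq_max => /andP[le16 lem].
have m_gt0 : (0 < m)%N by apply: leq_trans hm.
have le_mn : (m <= #|gT|)%N by apply: leq_trans lem; rewrite -mulnn; nia.
have := card_not_mPGSR hm le_mn le16.
rewrite /mPGSR_proportion; set K := #|skew_matrices gT m|; set B := #|_ :\: _|.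
have -> : #|mPGSR_matrices gT m| = (K - B)%N.
  have := cardsID (mPGSR_matrices gT m) (skew_matrices gT m).
  rewrite (setIidPr _); last by apply/subsetP => S /setIdP[].
  by rewrite -/K -/B => <-; rewrite addnK.
have leBK : (B <= K)%N by apply/subset_leq_card/subsetDl.
have K_gt0 : 0 < K%:R :> R.
  rewrite ltr0n; apply/card_gt0P; exists (const_mx set0); apply/skewP.
  by split=> [i j|i]; rewrite !mxE //; apply/setP => x; rewrite mem_invg !inE.
rewrite -(ler_nat R) [(B * _)%:R]natrM [(_ * K)%:R]natrM [(100 * _)%:R]natrM natrX => leB.
set s := Num.sqrt _; have s2 : s * s = #|gT|%:R by rewrite -expr2 sqr_sqrtr.
have les : 101%:R * m%:R <= s.
  rewrite -natrM -[leLHS]ger0_norm // -sqrtr_sqr ler_wsqrtr //.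
  by rewrite -natrX ler_nat.
have mR : 0 < m%:R :> R by rewrite ltr0n.
have lts : 100%:R * m%:R < s.
  by apply: lt_le_trans les; rewrite ltr_pM2r // ltr_nat.
have s_gt0 : 0 < s by apply: le_lt_trans lts; rewrite mulr_ge0.
rewrite natrB // mulrBl divff ?gt_eqF // ltrD2l ltrN2 ltr_pdivrMr // mulrAC.
rewrite ltr_pdivlMr // -(ltr_pM2r s_gt0) -mulrA s2; apply: le_lt_trans leB _.
have -> : 100%:R * m%:R ^+ 3 * K%:R = m%:R ^+ 2 * K%:R * (100%:R * m%:R) :> R by ring.
by rewrite ltr_pM2l // mulr_gt0 // exprn_gt0.
Qed.
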